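(* Let $s\ge 1$, let $n=2s+1$, and let $N$ be a positive integer coprime to $n+1$. For $t\in\mathbb R\setminus\{0\}$ let $S_t$ be the scaling of the projective invariants $a=(a_k^i)_{k\in\mathbb Z,\,1\le i\le n}$ of twisted $N$-gons in $\mathbb{RP}^n$ given by $$a_k^{2\ell+1}\mapsto t\,a_k^{2\ell+1}\ (\ell=0,\dots,s),\qquad a_k^{2\ell}\mapsto a_k^{2\ell}\ (\ell=1,\dots,s),\qquad k\in\mathbb Z .$$ Then the generalized pentagram map $T$ on $\mathbb{RP}^{2s+1}$, written as a map $a\mapsto T(a)$ on the projective invariants, is invariant under this scaling, i.e. $T(S_t a)=S_t\,T(a)$ for every $t\neq 0$, whenever both sides are defined. Equivalently, for every $k$, $T(a_k^{i})$ is homogeneous under the scaling, of degree $1$ if $i$ is odd and of degree $0$ if $i$ is even.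
   Context: Twisted polygons: a twisted $N$-gon in $\mathbb{RP}^n$ is a sequence $x=(x_k)_{k\in\mathbb Z}$ of points of $\mathbb{RP}^n$ such that $x_{k+N}=M\cdot x_k$ for all $k$, for a fixed projective transformation $M\in \mathrm{PSL}(n+1,\mathbb R)$ (the monodromy). A representative of $M$ in $\mathrm{SL}(n+1,\mathbb R)$, still denoted $M$, is fixed. Lifts and invariants: polygons are assumed nondegenerate, meaning that there are lifts $V_k\in\mathbb R^{n+1}$ of $x_k$ with $V_{k+N}=MV_k$ and $\det(V_k,V_{k+1},\dots,V_{k+n})=1$ for all $k$. Since $N$ and $n+1$ are coprime these lifts are unique (if $n$ is odd, up to one common sign). The projective invariants $a_k^i$ ($1\le i\le n$, $N$-periodic in $k$) are defined by $$V_{k+n+1}=a_k^nV_{k+n}+a_k^{n-1}V_{k+n-1}+\dots+a_k^1V_{k+1}+(-1)^nV_k .$$ Conversely any $N$-periodic family $a=(a_k^i)$ of real numbers determines via this recursion a sequence $(V_k)$ with $\det(V_k,\dots,V_{k+n})=1$, unique up to $\mathrm{SL}(n+1,\mathbb R)$, and a matrix $M\in\mathrm{SL}(n+1,\mathbb R)$ with $V_{k+N}=MV_k$. Generalized pentagram map ($n=2s+1$): let $P_k$ be the hyperplane of $\mathbb{RP}^n$ through the $2s+1$ vertices $x_{k-2s},x_{k-2s+2},\dots,x_{k-2},x_k,x_{k+2},\dots,x_{k+2s}$. It is assumed that these vertices determine $P_k$ uniquely for every $k$ and that any $n$ consecutive $P_k$'s meet in a single point. The map is $T(x)_k=P_{k-s}\cap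 P_{k-s+1}\cap\dots\cap P_{k+s}$; afterwards it is composed with the index shift $\sigma^s$ (where $\sigma(x_k)=x_{k+1}$), i.e. redefined so that the $k$-th new vertex is the point that was previously the $(k+s)$-th, and this map is still called $T$. The new polygon is twisted with the same monodromy $M$. Induced map on invariants: if $x$ has invariants $a$ and $T(x)$ is nondegenerate (with the same $M\in\mathrm{SL}(n+1,\mathbb R)$), then $T(a)$ denotes the family of invariants of $T(x)$, and $T(a_k^i)$ its components. A function $f$ of the invariants is homogeneous of degree $d$ under the scaling if $f(S_ta)=t^{d}f(a)$. *)

(* Defs.v *)
From HB Require Import structures.
From mathcomp Require Import all_boot all_order all_algebra.
From mathcomp Require Import reals.

Set Implicit Arguments.
Unset Strict Implicit.
Unset Printing Implicit Defensive.

Import Order.TTheory GRing.Theory Num.Theory.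
Local Open Scope ring_scope.

Section ProjectivePolygons.
Variables (R : realType) (n : nat).

(* Projective subspaces of RP^n are linear subspaces of R^(n+1), of linear
   dimension one more: a point is a line of R^(n+1), a hyperplane of RP^n is a
   subspace of dimension n, joins are sums and meets are intersections. *)
Definition psubspace := {vspace 'cV[R]_n.+1}.

Definition is_point (U : psubspace) : bool := \dim U == 1%N.
Definition is_hyperplane (U : psubspace) : bool := \dim U == n.

Definition pact (M : 'M[R]_n.+1) (U : psubspace) : psubspace :=
  (linfun (mulmx M : 'cV[R]_n.+1 -> 'cV[R]_n.+1) @: U)%VS.

Definition polygon := int -> psubspace.

(* The monodromy is given by a fixed representative in SL(n+1, R). *)
Definition twisted (N : nat) (M : 'M[R]_n.+1) (x : polygon) : Prop :=
  [/\ \det M = 1,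
      forall k, is_point (x k)
    & forall k, x (k + N%:Z) = pact M (x k)].

Definition index_shift (x : polygon) : polygon := fun k => x (k + 1).

(* The matrix with columns V_k, V_(k+1), ..., V_(k+n). *)
Definition window (V : int -> 'cV[R]_n.+1) (k : int) : 'M[R]_n.+1 :=
  \matrix_(i, j) V (k + (j : nat)%:Z) i 0.

Definition normalized_lift (N : nat) (M : 'M[R]_n.+1) (x : polygon)
    (V : int -> 'cV[R]_n.+1) : Prop :=
  [/\ forall k, x k = <[V k]>%VS,
      forall k, V (k + N%:Z) = M *m V k
    & forall k, \det (window V k) = 1].

(* Pitfall: ordinals start at 0, so a k i stands for a_k^(i+1). *)
Definition invariants := int -> 'I_n -> R.

Definition periodic (N : nat) (a : invariants) : Prop :=
  forall k i, a (k + N%:Z) i = a k i.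

Definition recursion (a : invariants) (V : int -> 'cV[R]_n.+1) : Prop :=
  forall k, V (k + n.+1%:Z) =
    \sum_(i < n) a k i *: V (k + i.+1%:Z) + (-1) ^+ n *: V k.

(* In particular x is nondegenerate with respect to the representative M: the
   nondegeneracy condition is the existence of V. *)
Definition has_invariants (N : nat) (M : 'M[R]_n.+1) (x : polygon)
    (a : invariants) : Prop :=
  exists2 V, normalized_lift N M x V & recursion a V.

Definition scaling (t : R) (a : invariants) : invariants :=
  fun k i => if odd i.+1 then t * a k i else a k i.

(* A partially defined real function of the invariants of twisted N-gons is
   given by its graph. *)
Definition homogeneous (N : nat) (f : invariants -> R -> Prop) (d : nat) :
    Prop :=
  forall (t : R) (a : invariants) (u v : R), t != 0 -> periodic N a ->
    f a u -> f (scaling t a) v -> v = t ^+ d * u.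

End ProjectivePolygons.

Section Pentagram.
Variables (R : realType) (s : nat).
Local Notation n := (s.*2.+1).

Implicit Type x : polygon R n.

(* The join of x_(k-2s), x_(k-2s+2), ..., x_(k+2s). *)
Definition diagonal x (k : int) : psubspace R n :=
  (\sum_(j < n) x (k - s.*2%:Z + j.*2%:Z)%R)%VS.

Definition unshifted_pentagram x : polygon R n :=
  fun k => (\bigcap_(j < n) diagonal x (k - s%:Z + (j : nat)%:Z)%R)%VS.

Definition pentagram x : polygon R n :=
  iter s (@index_shift R n) (unshifted_pentagram x).

Definition pentagram_defined x : Prop :=
  (forall k, is_hyperplane (diagonal x k)) /\
  (forall k,
     is_point (\bigcap_(j < n) diagonal x (k + (j : nat)%:Z)%R)%VS).

(* The graph of the partial map a |-> T(a).  The polygon x with invariants a is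
   determined by a up to projective equivalence; the same matrix M is used for
   the lifts of x and of its image. *)
Definition pentagram_inv (N : nat) (a b : invariants R n) : Prop :=
  exists M x,
    [/\ twisted N M x,
        has_invariants N M x a,
        pentagram_defined x
      & has_invariants N M (pentagram x) b].

Definition pentagram_component (N : nat) (k : int) (i : 'I_n)
    (a : invariants R n) (u : R) : Prop :=
  exists2 b, pentagram_inv N a b & b k i = u.

End Pentagram.

(* Main.v *)
Require Import Defs.
From HB Require Import structures.
From mathcomp Require Import all_boot all_order all_algebra.
From mathcomp Require Import reals.
From mathcomp Require Import zify.

(* The consecutive vertices V_k, ..., V_(k+n+1) satisfy a single linear relation,
   the recursion.  Its terms of odd index lie in the diagonals of one parity
   and, by the relation, also in those of the other parity, so
   w_k = sum_(i odd) a_k^i V_(k+i) spans the vertex of T(x) of index k+1.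
   A relation sum_i c_i w_(k+i) = 0 is a combination sum_j f_j D_(k+j) of instances of
   the recursion.  Each D_j splits into a half with the index parity of j and
   minus w_j, whose indices have the other parity; comparing parities and using
   that consecutive w's are independent gives f_j = 0 for j even and f_j = - c_j
   for j odd.  The scaling multiplies w by t, hence turns this identity
   into the same relation with c_i replaced by t c_i for i odd.  Since n + 1
   is even, the rescaling that normalizes the w's to a lift of T(x) is unaffected,
   up to a constant, because N and n + 1 are coprime. *)

Set Implicit Arguments.
Unset Strict Implicit.
Unset Printing Implicit Defensive.

Import Order.TTheory GRing.Theory Num.Theory.
Local Open Scope ring_scope.

Definition seq_free {R : fieldType} {U : lmodType R} (m : nat) (v : nat -> U) :
    Prop :=
  forall p : nat -> R,
    \sum_(j < m) p j *: v j = 0 -> forall j, (j < m)%N -> p j = 0.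

(** * Formal relations and their division by the recursion *)

Section ParityHalves.
Variables (R : fieldType) (U : lmodType R) (n : nat) (a : nat -> 'I_n -> R).
Implicit Types (v : nat -> U) (L : (nat -> U) -> U).

(* Ordinals start at 0: [a j i] multiplies the term of index [j + i.+1], so an even
   [i] is an odd index in the paper. *)
Definition odd_half v j : U :=
  \sum_(i < n | ~~ odd i) a j i *: v (j + i.+1)%N.

Definition even_half v j : U :=
  v (j + n.+1)%N - \sum_(i < n | odd i) a j i *: v (j + i.+1)%N + v j.

(* A formal linear combination, encoded as an operator on all sequences so that
   a sequence can be replaced by its even- or odd-indexed part. *)
Definition finite_comb r L : Prop :=
  exists p : nat -> R, forall v, L v = \sum_(j < r) p j *: v j.

Lemma finite_comb_eval {r j} : (j < r)%N -> finite_comb r (@^~ j).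
Proof.
move=> jr; exists (fun i => (i == j)%:R) => v.
rewrite (bigD1 (Ordinal jr)) //= eqxx scale1r big1 ?addr0 // => i.
by rewrite -val_eqE /= => /negbTE ->; rewrite scale0r.
Qed.

Lemma finite_comb0 r : finite_comb r (fun=> 0).
Proof. by exists (fun=> 0) => v; rewrite big1 // => i _; rewrite scale0r. Qed.

Lemma finite_combD {r L1 L2} : finite_comb r L1 -> finite_comb r L2 ->
  finite_comb r (fun v => L1 v + L2 v).
Proof.
move=> [p Hp] [q Hq]; exists (fun j => p j + q j) => v.
by rewrite Hp Hq -big_split; apply: eq_bigr => i _; rewrite scalerDl.
Qed.

Lemma finite_combZ {r L} c : finite_comb r L -> finite_comb r (fun v => c *: L v).
Proof.
move=> [p Hp]; exists (fun j => c * p j) => v.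
by rewrite Hp scaler_sumr; apply: eq_bigr => i _; rewrite scalerA.
Qed.

Lemma finite_combB {r L1 L2} : finite_comb r L1 -> finite_comb r L2 ->
  finite_comb r (fun v => L1 v - L2 v).
Proof.
move=> H1 /(finite_combZ (-1)) H2; have [p Hp] := finite_combD H1 H2.
by exists p => v; rewrite -Hp scaleN1r.
Qed.

Lemma finite_comb_sum {r} {I : Type} (s : seq I) (P : pred I)
    (L : I -> (nat -> U) -> U) :
    (forall i, P i -> finite_comb r (L i)) ->
  finite_comb r (fun v => \sum_(i <- s | P i) L i v).
Proof.
move=> HL; elim: s => [|i s [p Hp]].
  by have [p Hp] := finite_comb0 r; exists p => v; rewrite big_nil; apply: Hp.
have [Pi|nPi] := boolP (P i); last first.
  by exists p => v; rewrite big_cons (negbTE nPi) Hp.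
have [|q Hq] := @finite_combD r (L i) (fun v => \sum_(i <- s | P i) L i v) (HL i Pi).
  by exists p.
by exists q => v; rewrite big_cons Pi Hq.
Qed.

(* Division by the recursion [even_half v = odd_half v]. *)
Lemma finite_comb_div q L v :
    seq_free n.+1 v -> (forall j, even_half v j = odd_half v j) ->
    finite_comb (n.+1 + q) L -> L v = 0 ->
  exists f : nat -> R, forall u,
    L u = \sum_(j < q) f j *: (even_half u j - odd_half u j).
Proof.
move=> fv rv; elim: q L => [|q IHq] L.
  rewrite addn0 => -[p Hp] Lv0; exists (fun=> 0) => u.
  rewrite big_ord0 Hp big1 // => j _.
  by rewrite (fv p) ?scale0r // -Hp.
move=> [p Hp] Lv0.
(* The top term [u (n.+1 + q)] of [even_half u q] has coefficient 1, so this subtraction shortens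
   the combination by one term. *)
pose L' u := L u - p (n.+1 + q)%N *: (even_half u q - odd_half u q).
have [||f Hf] := IHq L'.
- have H1 : finite_comb (n.+1 + q) (fun u => \sum_(j < n.+1 + q) p j *: u j).
    by exists p.
  have H2 (P : pred 'I_n) : finite_comb (n.+1 + q)
      (fun u => \sum_(i < n | P i) a q i *: u (q + i.+1)%N).
    apply: finite_comb_sum => i _; apply/finite_combZ/finite_comb_eval.
    by rewrite addnC ltn_add2r ltnS.
  have qr : (q < n.+1 + q)%N by rewrite addSn ltnS leq_addl.
  have [g Hg] := finite_combB H1 (finite_combZ (p (n.+1 + q)%N)
    (finite_combB (finite_combB (finite_comb_eval qr) (H2 (fun i => odd i)))
       (H2 (fun i => ~~ odd i)))).
  exists g => u; rewrite -Hg /L' Hp addnS big_ord_recr /= /even_half /odd_half.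
  rewrite (addnC q n.+1); set x := u (n.+1 + q)%N; set y := \sum_(i < n | odd i) _.
  rewrite [x - y + u q - _](_ : _ = x + (u q - y - \sum_(i < n | ~~ odd i)
    a q i *: u (q + i.+1)%N)); last by rewrite [x - y + _]addrAC -!addrA.
  by rewrite scalerDr opprD addrA addrK.
- by rewrite /L' Lv0 rv subrr scaler0 subrr.
exists (fun j => if (j == q)%N then p (n.+1 + q)%N else f j) => u.
rewrite big_ord_recr /= eqxx -[L u](subrK (p (n.+1 + q)%N *: (even_half u q - odd_half u q))).
rewrite -/(L' u) Hf; congr (_ + _); apply: eq_bigr => j _.
by rewrite (ltn_eqF (ltn_ord j)).
Qed.

Lemma odd_half_mask (b : bool) v j :
  odd_half (fun i => if odd i == b then v i else 0) j =
    if odd j == b then 0 else odd_half v j.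
Proof.
rewrite /odd_half; case: ifP => jb.
  rewrite big1 // => i /negbTE iE; rewrite oddD /= iE addbT.
  by move: jb; case: (odd j); case: b; rewrite //= scaler0.
apply: eq_bigr => i /negbTE iE; rewrite oddD /= iE addbT.
by move: jb; case: (odd j); case: b.
Qed.

Lemma even_half_mask (b : bool) v j : odd n ->
  even_half (fun i => if odd i == b then v i else 0) j =
    if odd j == b then even_half v j else 0.
Proof.
move=> on; rewrite /even_half oddD /= on addbF; case: ifP => jb; last first.
  rewrite big1 ?subr0 ?addr0 // => i iO.
  by rewrite oddD /= iO addbF jb scaler0.
by congr (_ - _ + _); apply: eq_bigr => i iO; rewrite oddD /= iO addbF jb.
Qed.

(* Comparing the two parities in the division of the given relation by the
   recursion forces the quotient to be minus the odd part of [c]. *)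
Lemma odd_half_relation_scale t (c : nat -> R) v v' :
    odd n -> seq_free n.+1 v -> seq_free n.+1 (odd_half v) ->
    (forall j, even_half v j = odd_half v j) ->
    (forall j, even_half v' j = t *: odd_half v' j) ->
    \sum_(i < n.+2) c i *: odd_half v i = 0 ->
  \sum_(i < n.+2) (if odd i then t * c i else c i) *: odd_half v' i = 0.
Proof.
move=> on fv fw rv rv' c0.
have [f Hf] : exists f : nat -> R, forall u,
    \sum_(i < n.+2) c i *: odd_half u i =
    \sum_(j < n.+1) f j *: (even_half u j - odd_half u j).
  (* The largest index that occurs is [(n + 1) + n], so the length is [n.+1 + n.+1] and [n + 1]
     quotients suffice. *)
  apply: (finite_comb_div fv rv _ c0).
  apply: finite_comb_sum => i _; apply/finite_combZ/finite_comb_sum => j _.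
  apply/finite_combZ/finite_comb_eval; have := ltn_ord i; have := ltn_ord j.
  lia.
have fE j : (j < n.+1)%N -> f j = if odd j then - c j else 0.
  move=> jn.
  pose u i := if odd i == false then v i else 0.
  have : \sum_(j < n.+1) (if odd j then c j + f j else - f j) *: odd_half v j = 0.
    (* Since [n + 1] is even, the mask kills the last term; only [n + 1] consecutive halves remain,
       and these are independent. *)
    have /eqP := Hf u; rewrite big_ord_recr /= odd_half_mask /= on /= scaler0 addr0.
    rewrite -subr_eq0 -sumrB => /eqP E; rewrite -[RHS]E; apply: eq_bigr => i _.
    rewrite odd_half_mask even_half_mask // rv; case: (odd i) => /=.
      by rewrite sub0r scalerN opprK scalerDl.
    by rewrite scaler0 subr0 sub0r scaleNr.
  move/(fw (fun j => if odd j then c j + f j else - f j))/(_ j jn).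
  by case: ifP => _ /eqP; rewrite ?oppr_eq0 ?addr_eq0 => /eqP // ->; rewrite opprK.
(* With [f] known, the odd-indexed part of [v'] leaves the even terms on the left and [- t] times
   the odd ones on the right. *)
pose u i := if odd i == true then v' i else 0.
have /eqP := Hf u; rewrite -subr_eq0 [X in _ - X](_ : _ =
  - \sum_(i < n.+2) (if odd i then t * c i else 0) *: odd_half v' i); last first.
  rewrite [in RHS]big_ord_recr /= on /= scale0r addr0 -sumrN; apply: eq_bigr => i _.
  rewrite odd_half_mask even_half_mask // fE ?ltn_ord //; case: (odd i) => /=.
    by rewrite subr0 rv' scalerA mulNr scaleNr mulrC.
  by rewrite !scale0r oppr0.
rewrite opprK -big_split => /eqP E; rewrite -[RHS]E; apply: eq_bigr => i _ /=.
rewrite odd_half_mask; case: (odd i) => /=.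
  by rewrite scaler0 add0r.
by rewrite scale0r addr0.
Qed.
End ParityHalves.

(** By Bezout, 1 is a multiple of [N] minus a multiple of [m], so [r] has period 1. *)
Lemma coprime_periods_const (T : Type) (r : int -> T) (N m : nat) :
    (0 < N)%N -> coprime N m ->
    (forall k, r (k + N%:Z) = r k) -> (forall k, r (k + m%:Z) = r k) ->
  forall k (i : nat), r (k + i%:Z) = r k.
Proof.
move=> N0 coNm rN rm.
have rmul p : (forall k, r (k + p%:Z) = r k) ->
    forall (u : nat) k, r (k + (u * p)%N%:Z) = r k.
  move=> rp; elim=> [|u IHu] k; first by rewrite mul0n addr0.
  by rewrite mulSn PoszD addrA IHu rp.
have [u v uv _] := egcdnP m N0.
move=> k; elim=> [|i <-]; first by rewrite addr0.
rewrite -[RHS](rmul _ rN u) uv (eqP coNm) -(rmul _ rm v).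
by congr r; lia.
Qed.

(** * Normalized lifts and their rescaling *)

Section Lifts.
Variable R : realType.

Lemma window_seq_free n (V : int -> 'cV[R]_n.+1) k :
  \det (window V k) = 1 -> seq_free n.+1 (fun j => V (k + j%:Z)).
Proof.
move=> detV p p0 j jn.
have wu : window V k \in unitmx by rewrite unitmxE detV unitr1.
pose q : 'cV[R]_n.+1 := \col_i p i.
suff /matrixP/(_ (Ordinal jn) 0) : q = 0 by rewrite !mxE.
rewrite -[q](mulKmx wu) (_ : _ *m q = 0) ?mulmx0 // -[RHS]p0.
apply/matrixP => i l; rewrite ord1 !mxE summxE; apply: eq_bigr => h _.
by rewrite !mxE mulrC.
Qed.

Lemma window_neq0 n (V : int -> 'cV[R]_n.+1) k : \det (window V k) = 1 -> V k != 0.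
Proof.
move=> /window_seq_free fV; apply/eqP => V0.
have := fV (fun j => (j == 0)%:R); rewrite big_ord_recl /= addr0 V0 scaler0.
rewrite big1 ?addr0 => [/(_ erefl 0%N isT)/eqP|i _]; last exact: scale0r.
by rewrite oner_eq0.
Qed.

Definition odd_vertex {n} (a : invariants R n) (V : int -> 'cV[R]_n.+1) (k : int) :
    'cV[R]_n.+1 :=
  \sum_(i < n | ~~ odd i) a k i *: V (k + i.+1%:Z).

Lemma odd_vertex_half n (a : invariants R n) V k j :
  odd_half (fun j => a (k + j%:Z)) (fun j => V (k + j%:Z)) j =
  odd_vertex a V (k + j%:Z).
Proof. by apply: eq_bigr => i _; rewrite PoszD addrA. Qed.

Lemma even_vertex_half n (a : invariants R n) (V : int -> 'cV[R]_n.+1) k j :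
  even_half (fun j => a (k + j%:Z)) (fun j => V (k + j%:Z)) j =
  V (k + j%:Z + n.+1%:Z)
    - \sum_(i < n | odd i) a (k + j%:Z) i *: V (k + j%:Z + i.+1%:Z) + V (k + j%:Z).
Proof.
rewrite /even_half PoszD addrA; congr (_ - _ + _).
by apply: eq_bigr => i _; rewrite PoszD addrA.
Qed.

Lemma odd_vertex_scaling n t (a : invariants R n) V k :
  odd_vertex (scaling t a) V k = t *: odd_vertex a V k.
Proof.
rewrite /odd_vertex scaler_sumr; apply: eq_bigr => i iE.
by rewrite /scaling /= iE scalerA.
Qed.

Lemma recursion_halves n (a : invariants R n) V : odd n -> recursion a V ->
  forall k, V (k + n.+1%:Z) - \sum_(i < n | odd i) a k i *: V (k + i.+1%:Z) + V k =
    odd_vertex a V k.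
Proof.
move=> on rV k; rewrite rV -signr_odd on expr1 scaleN1r (bigID (fun i : 'I_n => odd i)) /=.
by rewrite addrAC subrK addrAC subrr add0r.
Qed.

(** * Incidence of the vectors w_k with the diagonals *)

Section Line.
Variable s : nat.
Local Notation n := (s.*2.+1).
Variables (x : polygon R n) (a : invariants R n) (V : int -> 'cV[R]_n.+1).
Hypotheses (xV : forall k, x k = <[V k]>%VS) (rV : recursion a V).

Lemma mem_diagonal k l (j : nat) : (j < n)%N -> l = k - s.*2%:Z + j.*2%:Z ->
  V l \in diagonal x k.
Proof.
move=> jn ->; rewrite memvE -xV.
exact: (sumv_sup (Ordinal jn) isT (subvv _)).
Qed.

(** The vertices spanning this diagonal have indices of the parity of [k + 1 + j]. For even [j] they
    include the terms of [odd_vertex], for odd [j] those of the other side of the recursion. *)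
Lemma odd_vertex_diagonal k (j : nat) : (j < n)%N ->
  odd_vertex a V k \in diagonal x (k + 1 + j%:Z).
Proof.
move=> jn; have [oj|ej] := boolP (odd j); last first.
  apply: rpred_sum => i iE; apply/rpredZ.
  apply: (@mem_diagonal _ _ (i./2 + s - j./2)%N); have := ltn_ord i; lia.
rewrite -recursion_halves //=; last by rewrite odd_double.
apply: rpredD; first apply: rpredB.
- apply: (@mem_diagonal _ _ (s.+1 + s - (j.+1)./2)%N); lia.
- apply: rpred_sum => i iO; apply/rpredZ.
  apply: (@mem_diagonal _ _ ((i.+1)./2 + s - (j.+1)./2)%N); have := ltn_ord i; lia.
apply: (@mem_diagonal _ _ (s - (j.+1)./2)%N); lia.
Qed.

(** The index shift by [s] cancels the offset [- s], so vertex [k + 1] is the meet of the diagonals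
    [k + 1], ..., [k + n]. *)
Lemma odd_vertex_pentagram k : odd_vertex a V k \in pentagram x (k + 1).
Proof.
have shiftE y m l : iter m (@index_shift R n) y l = y (l + m%:Z).
  elim: m l => [|m IHm] l; first by rewrite addr0.
  by rewrite iterS /index_shift IHm; congr y; lia.
rewrite /pentagram shiftE /unshifted_pentagram memvE; apply/subv_bigcapP => j _.
by rewrite addrK -memvE; apply/odd_vertex_diagonal/ltn_ord.
Qed.

(* If all odd coefficients of the recursion at [k] vanished, [V (k + n + 1)]
   would lie in the span of [V k, V (k + 2), ..., V (k + n - 1)]: two of the
   vertices spanning a diagonal would be redundant. *)
Lemma odd_vertex_neq0 (k : int) : (1 <= s)%N ->
  is_hyperplane (diagonal x (k + s.*2%:Z)) -> odd_vertex a V k != 0.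
Proof.
move=> s1 /eqP dimH; apply/eqP => w0.
(* Position [s.+1] is that of [V (k + n + 1)], as [2 (s + 1) = n + 1]; it occurs in the diagonal
   because [s] is at least 1. *)
have jn : (s.+1 < n)%N by lia.
pose j0 := Ordinal jn.
pose D := (\sum_(j < n | j != j0) x (k + j.*2%:Z)%R)%VS.
have mem_D l (j : nat) : (j < n)%N -> j != j0 :> nat -> l = k + j.*2%:Z -> V l \in D.
  move=> jn' jj -> ; rewrite memvE -xV.
  by apply: (sumv_sup (Ordinal jn')); rewrite ?subvv.
have sub : (diagonal x (k + s.*2%:Z) <= D)%VS.
  apply/subv_sumP => j _; rewrite addrK.
  have [jE|jj] := eqVneq (j : nat) s.+1; last by rewrite xV -memvE (mem_D _ j).
  have <- : k + n.+1%:Z = k + j.*2%:Z by lia.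
  have on : odd n by rewrite /= odd_double.
  have /eqP := recursion_halves on rV k.
  rewrite w0 addr_eq0 subr_eq => /eqP VE.
  rewrite xV -memvE VE; apply: rpredD; last first.
    apply: rpred_sum => i iO; apply/rpredZ.
    by apply: (mem_D _ (i.+1)./2); have := ltn_ord i; rewrite /=; lia.
  by rewrite rpredN; apply: (mem_D _ 0%N); rewrite ?addr0.
have := dimvS sub; rewrite dimH leqNgt => /negP; apply.
apply: leq_ltn_trans (dimv_leq_sum _ _ _) _.
apply: leq_ltn_trans (_ : (\sum_(j < n | j != j0) 1)%N < n)%N.
  by apply: leq_sum => j _; rewrite xV dim_vline leq_b1.
by rewrite sum1_card cardC1 card_ord.
Qed.

End Line.

(** Both [odd_vertex a V k] and [W (k + 1)] lie on the line of the same image vertex, whence [mu].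
    It is [N]-periodic because one matrix [M] translates both vectors. *)
Lemma pentagram_inv_lift s N (a b : invariants R s.*2.+1) :
    (1 <= s)%N -> periodic N a -> pentagram_inv N a b ->
  exists V W mu,
    [/\ recursion a V, forall k, \det (window V k) = 1,
        recursion b W & forall k, \det (window W k) = 1] /\
    [/\ forall k, mu k != 0, forall k, mu (k + N%:Z) = mu k
      & forall k, odd_vertex a V k = mu k *: W (k + 1)].
Proof.
move=> s1 pa [M [x [[detM _ _] [V [xV VM detV] rV] [hyp _] [W [TxW WM detW] rW]]]].
have ex k : {mu | odd_vertex a V k == mu *: W (k + 1)}.
  apply: sigW; have := odd_vertex_pentagram xV rV k.
  by rewrite TxW => /vlineP[mu ->]; exists mu.
pose mu k := sval (ex k).
have muE k : odd_vertex a V k = mu k *: W (k + 1) by apply/eqP/(svalP (ex k)).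
exists V, W, mu; split=> //; split=> // k.
  have := odd_vertex_neq0 (k := k) xV rV s1 (hyp _).
  by rewrite muE; apply: contraNneq => ->; rewrite scale0r.
have Mu : M \in unitmx by rewrite unitmxE detM unitr1.
have wN : odd_vertex a V (k + N%:Z) = M *m odd_vertex a V k.
  rewrite mulmx_sumr; apply: eq_bigr => i _.
  by rewrite pa addrAC VM scalemxAr.
have /eqP : mu (k + N%:Z) *: W (k + 1) = mu k *: W (k + 1).
  apply: (can_inj (mulKmx Mu)).
  rewrite -[mu k *: _]muE -wN -scalemxAr -WM addrAC.
  by rewrite muE.
rewrite -subr_eq0 -scalerBl scaler_eq0 (negbTE (window_neq0 (detW _))) orbF.
by rewrite subr_eq0 => /eqP.
Qed.

(* With [W (k + 1) = (mu k)^-1 *: odd_vertex a V k], scaling the recursion of [W]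
   gives a recursion for [(mu k)^-1 *: odd_vertex a V' k], a rescaling of [W'];
   comparing it with the recursion of [W'] shows that the rescaling factor has
   period [n + 1], besides [N], and hence is constant. *)
Lemma pentagram_inv_scaling s N t (a b c : invariants R s.*2.+1) :
    (1 <= s)%N -> (0 < N)%N -> coprime N s.*2.+2 -> t != 0 -> periodic N a ->
    pentagram_inv N a b -> pentagram_inv N (scaling t a) c ->
  c =2 scaling t b.
Proof.
set n := s.*2.+1 => s1 N0 coNn t0 pa.
have on : odd n by rewrite /n /= odd_double.
have pta : periodic N (scaling t a) by move=> k i; rewrite /scaling pa.
move=> /(pentagram_inv_lift s1 pa)[V [W [mu [[rV dV rW dW] [mu0 muN muE]]]]].
move=> /(pentagram_inv_lift s1 pta)[V' [W' [mu' [[rV' dV' rW' dW'] [mu'0 mu'N mu'E]]]]].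
have sum3 (F : nat -> 'cV[R]_n.+1) :
    \sum_(i < n.+2) F i = F 0%N + (\sum_(i < n) F i.+1 + F n.+1).
  by rewrite big_ord_recl big_ord_recr.
pose lam k := (mu k)^-1.
have lamE k : lam k *: odd_vertex a V k = W (k + 1).
  by rewrite muE scalerA mulVf ?scale1r.
(* The factor [t^-1] appears because [mu'] refers to the odd vertex of [scaling t a], which is [t]
   times that of [a]. *)
pose sig k := lam k * t^-1 * mu' k.
have sig0 k : sig k != 0 by rewrite !mulf_neq0 ?invr_neq0.
have sigE k : lam k *: odd_vertex a V' k = sig k *: W' (k + 1).
  rewrite -[odd_vertex a V' k](scalerK t0) -odd_vertex_scaling mu'E.
  by rewrite !scalerA.
have rel k : sig (k + n.+1%:Z) *: W' (k + 1 + n.+1%:Z) =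
    \sum_(i < n) (scaling t b (k + 1) i * sig (k + i.+1%:Z)) *: W' (k + 1 + i.+1%:Z)
    - sig k *: W' (k + 1).
  (* The recursion of [W] at [k + 1], moved to one side and written in the vectors w; both ends have
     coefficient [- lam] because [n] is odd. *)
  pose g j := if j == 0%N then - lam k else if j == n.+1 then - lam (k + n.+1%:Z)
    else b (k + 1) (inord j.-1) * lam (k + j%:Z).
  have gE (i : 'I_n) : g i.+1 = b (k + 1) i * lam (k + i.+1%:Z).
    by rewrite /g /= eqSS ltn_eqF ?ltn_ord // inord_val.
  have gn : g n.+1 = - lam (k + n.+1%:Z) by rewrite /g /= eqxx.
  have fw : seq_free n.+1 (odd_half (fun j => a (k + j%:Z)) (fun j => V (k + j%:Z))).
    move=> p p0 j jn; apply: (mulIf (mu0 (k + j%:Z))); rewrite mul0r.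
    apply: (window_seq_free (dW (k + 1)) (p := fun j => p j * mu (k + j%:Z))) jn.
    rewrite -[RHS]p0; apply: eq_bigr => i _.
    by rewrite odd_vertex_half muE scalerA [k + 1 + _]addrAC.
  have rv j : even_half (fun j => a (k + j%:Z)) (fun j => V (k + j%:Z)) j =
      odd_half (fun j => a (k + j%:Z)) (fun j => V (k + j%:Z)) j.
    by rewrite even_vertex_half odd_vertex_half recursion_halves.
  have rv' j : even_half (fun j => a (k + j%:Z)) (fun j => V' (k + j%:Z)) j =
      t *: odd_half (fun j => a (k + j%:Z)) (fun j => V' (k + j%:Z)) j.
    rewrite even_vertex_half odd_vertex_half -odd_vertex_scaling.
    rewrite -(recursion_halves on rV'); congr (_ - _ + _).
    by apply: eq_bigr => i iO; rewrite /scaling /= iO.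
  pose w := odd_half (fun j => a (k + j%:Z)) (fun j => V (k + j%:Z)).
  have grel : \sum_(i < n.+2) g i *: w i = 0.
    rewrite (sum3 (fun i => g i *: w i)) gn /w !odd_vertex_half addr0 !scaleNr !lamE.
    rewrite [k + _ + 1]addrAC rW -signr_odd on expr1 scaleN1r.
    rewrite (eq_bigr (fun i : 'I_n => b (k + 1) i *: W (k + 1 + i.+1%:Z))); last first.
      by move=> i _; rewrite odd_vertex_half gE -scalerA lamE [k + _ + 1]addrAC.
    by rewrite opprD opprK addNKr addNr.
  have := odd_half_relation_scale on (window_seq_free (dV k)) fw rv rv' grel.
  pose w' := odd_half (fun j => a (k + j%:Z)) (fun j => V' (k + j%:Z)).
  rewrite (sum3 (fun i => (if odd i then t * g i else g i) *: w' i)).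
  have -> : odd n.+1 = false by rewrite /= odd_double.
  rewrite addrA addrC => /eqP; rewrite gn /w' /= !odd_vertex_half addr0 !scaleNr.
  rewrite !sigE [k + _ + 1]addrAC addrC subr_eq0 => /eqP <-.
  rewrite addrC; congr (_ - _); apply: eq_bigr => i _.
  rewrite gE odd_vertex_half /scaling /= [k + 1 + _]addrAC.
  rewrite -[RHS]scalerA -sigE scalerA.
  by case: (odd i); rewrite /= ?mulrA.
have sigP k : sig (k + n.+1%:Z) = sig k /\
    forall i, c (k + 1) i * sig (k + n.+1%:Z) = scaling t b (k + 1) i * sig (k + i.+1%:Z).
  (* Coefficients of [rel] minus [sig (k + n + 1)] times the recursion of [W']; the top terms
     cancel, leaving [n + 1] independent vectors. *)
  pose p j := if j == 0%N then sig (k + n.+1%:Z) - sig k else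
    scaling t b (k + 1) (inord j.-1) * sig (k + j%:Z)
      - c (k + 1) (inord j.-1) * sig (k + n.+1%:Z).
  have pE (i : 'I_n) : p i.+1 = scaling t b (k + 1) i * sig (k + i.+1%:Z)
      - c (k + 1) i * sig (k + n.+1%:Z) by rewrite /p /= inord_val.
  have p0 : forall j, (j < n.+1)%N -> p j = 0.
    apply: (window_seq_free (dW' (k + 1))).
    have /eqP := rel k; rewrite rW' -signr_odd on expr1 scaleN1r eq_sym -subr_eq0.
    move=> /eqP E; rewrite -[RHS]E big_ord_recl addr0 scalerDr scaler_sumr.
    rewrite (eq_bigr (fun i : 'I_n =>
      (scaling t b (k + 1) i * sig (k + i.+1%:Z)) *: W' (k + 1 + i.+1%:Z)
      - sig (k + n.+1%:Z) *: (c (k + 1) i *: W' (k + 1 + i.+1%:Z)))); last first.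
      by move=> i _; rewrite pE scalerBl scalerA [sig _ * c _ _]mulrC.
    rewrite sumrB /p /= scalerBl scalerN opprD opprK.
    by rewrite addrC [RHS]addrACA [X in _ = _ + X]addrC.
  split; first by apply/eqP; rewrite -subr_eq0; apply/eqP/(p0 0%N).
  by move=> i; have /eqP := p0 i.+1 (ltn_ord i); rewrite pE subr_eq0 => /eqP.
have sigN k : sig (k + N%:Z) = sig k.
  have lamN : lam (k + N%:Z) = lam k by rewrite /lam muN.
  by rewrite /sig lamN mu'N.
have sigC := coprime_periods_const N0 coNn sigN (fun k => (sigP k).1).
move=> k i; rewrite -[k](subrK 1); apply: (mulIf (sig0 (k - 1))).
by have := (sigP (k - 1)).2 i; rewrite !sigC.
Qed.
End Lifts.

Theorem theorem3p3 (R : realType) (s N : nat)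
    (hs : (1 <= s)%N) (hN : (0 < N)%N) (hco : coprime N s.*2.+2) :
  (forall (t : R) (a b c : invariants R s.*2.+1),
     t != 0 -> periodic N a ->
     pentagram_inv N a b -> pentagram_inv N (scaling t a) c ->
     c =2 scaling t b) /\
  (forall (k : int) (i : 'I_s.*2.+1),
     homogeneous N (@pentagram_component R s N k i)
       (if odd i.+1 then 1%N else 0%N)).
Proof.
split=> [t a b c t0 pa|k i t a u v t0 pa [b ab <-] [c tac <-]].
  exact: pentagram_inv_scaling.
rewrite (pentagram_inv_scaling hs hN hco t0 pa ab tac) /scaling.
by case: ifP => _; rewrite ?expr1 ?expr0 ?mul1r.
Qed.
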